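(* Let $\{\mu_i(x) : i\in[n]\}$ be a blending basis sequence on $[0,1]$, let $\{x_h\}_{h=0}^m\subseteq[0,1]$ be a real increasing sequence, and let $A=[\mu_i(x_h)]_{h=0,i=0}^{m,n}\in\mathbb{R}^{(m+1)\times(n+1)}$ be the corresponding collocation matrix. Suppose that $A$ has full column rank and that the number $m+1$ of data points $q_0,\dots,q_m\in\mathbb{R}^d$ is larger than the number $n+1$ of control points. Let $\{\mathrm{I}_i\}_{i=0}^{\imath}$ be any partition of $[n]$, let $p_0^{(0)},\dots,p_n^{(0)}\in\mathbb{R}^d$ be any initial control points, and let $C^{(k)}(x)=\sum_{i=0}^n\mu_i(x)p_i^{(k)}$, $k=0,1,2,\dots$, be the fitting curves generated by the randomized progressive iterative approximation (RPIA) for curves. Then the sequence of fitting curves converges in expectation to the least-squares fitting solution of the data points; that is, if $(p_0^*,\dots,p_n^* )$ denotes the least-squares control points, then $$\lim_{k\to\infty}\mathbb{E}\big[p_i^{(k)}\big]=p_i^*\quad\text{for every } i\in[n],$$ so that $\lim_{k\to\infty}\mathbb{E}[C^{(k)}(x)]=\sum_{i=0}^n\mu_i(x)p_i^*$ for every $x\in[x_0,x_m]$.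
   Context: Notation: $[\ell]=\{0,1,\dots,\ell\}$. A blending basis sequence is a finite sequence of real-valued basis functions $\mu_0,\dots,\mu_n$ on $[0,1]$ (for example, B-splines); no further property of it is specified. The data points are $q_0,\dots,q_m\in\mathbb{R}^d$ ($d=2,3$), with $q_j$ attached to the parameter $x_j$. A partition $\{\mathrm{I}_i\}_{i=0}^{\imath}$ of $[n]$ is a family of (nonempty) pairwise disjoint subsets with union $[n]$. Least-squares fitting solution: the control points $p^*=[p_0^*\ \cdots\ p_n^*]^T$ minimizing $\sum_{j=0}^m\|q_j-\sum_{i=0}^n\mu_i(x_j)p_i\|^2$; equivalently $A^TAp^*=A^Tq$, i.e. $p^*=(A^TA)^{-1}A^Tq$ when $A$ has full column rank, where $q=[q_0\ \cdots\ q_m]^T\in\mathbb{R}^{(m+1)\times d}$. The least-squares fitting curve is $\sum_i\mu_i(x)p_i^*$. RPIA for curves: the initial control points $p_i^{(0)}$ are given (deterministic). For $k=0,1,2,\dots$: (1) Form $C^{(k)}(x)=\sum_{i=0}^n\mu_i(x)p_i^{(k)}$ and the differences $r_j^{(k)}=q_j-C^{(k)}(x_j)$, $j\in[m]$. (2) Choose a random index $\imath_k\in[\imath]$, independently of the previous choices, with $$\mathrm{P}(\imath_k=s)=\frac{\sum_{i\in\mathrm{I}_s}\sum_{j=0}^m\mu_i^2(x_j)}{\sum_{i=0}^n\sum_{j=0}^m\mu_i^2(x_j)},\quad s\in[\imath].$$ (3) For $i\in\mathrm{I}_{\imath_k}$ set $$\delta_i^{(k)}=\frac{\sum_{j=0}^m\mu_i(x_j)r_j^{(k)}}{\sum_{i'\in\mathrm{I}_{\imath_k}}\sum_{j=0}^m\mu_{i'}^2(x_j)},$$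 and set $\delta_i^{(k)}=0$ for $i\notin\mathrm{I}_{\imath_k}$. (4) Set $p_i^{(k+1)}=p_i^{(k)}+\delta_i^{(k)}$ for all $i\in[n]$ (so only control points indexed by $\mathrm{I}_{\imath_k}$ change). The expectation $\mathbb{E}$ is over the random choices $\imath_0,\imath_1,\dots$. *)

(* Defs.v *)
From mathcomp Require Export all_boot all_order all_algebra.

Set Implicit Arguments.
Unset Strict Implicit.
Unset Printing Implicit Defensive.

(* Stated before the classical sets are loaded: they reuse the notations of
   finset. *)
Definition indexed_partition (S T : finType) (I : S -> {set T}) : Prop :=
  [/\ forall s, I s <> set0,
      forall s t, s != t -> [disjoint I s & I t] &
      \bigcup_s I s = [set: T]].

From mathcomp Require Export all_classical all_reals all_analysis.

Import Order.TTheory GRing.Theory Num.Theory.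
Import numFieldNormedType.Exports.

Local Open Scope classical_set_scope.
Local Open Scope ring_scope.

(* The index set [l] = {0, ..., l} is 'I_l.+1.  A family of points of R^d is a
   matrix whose i-th row is the i-th point.  A blending basis is given by total
   functions R -> R, of which only the values on [0, 1] are ever used. *)

(* Kept apart from the library norm on 'rV_d, which is the sup norm. *)
Definition sqnorm2 (R : realType) (d : nat) (v : 'rV[R]_d) : R :=
  \sum_(c < d) v ord0 c ^+ 2.

Section Fitting.
Variables (R : realType) (m n d : nat).
Variables (mu : 'I_n.+1 -> R -> R) (x : 'I_m.+1 -> R) (q : 'M[R]_(m.+1, d)).

Definition collocation_mx : 'M[R]_(m.+1, n.+1) :=
  \matrix_(h < m.+1, i < n.+1) mu i (x h).

Definition curve (p : 'M[R]_(n.+1, d)) (t : R) : 'rV[R]_d :=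
  \sum_(i < n.+1) mu i t *: row i p.

Definition residual (p : 'M[R]_(n.+1, d)) (j : 'I_m.+1) : 'rV[R]_d :=
  row j q - curve p (x j).

Definition least_squares_points (p : 'M[R]_(n.+1, d)) : Prop :=
  forall p' : 'M[R]_(n.+1, d),
    \sum_(j < m.+1) sqnorm2 (residual p j) <=
    \sum_(j < m.+1) sqnorm2 (residual p' j).

Section Rpia.
Variables (l : nat) (I : 'I_l.+1 -> {set 'I_n.+1}).

Definition block_weight (s : 'I_l.+1) : R :=
  \sum_(i in I s) \sum_(j < m.+1) mu i (x j) ^+ 2.

Definition total_weight : R :=
  \sum_(i < n.+1) \sum_(j < m.+1) mu i (x j) ^+ 2.

Definition rpia_delta (p : 'M[R]_(n.+1, d)) (s : 'I_l.+1) (i : 'I_n.+1) :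
    'rV[R]_d :=
  if i \in I s then
    (block_weight s)^-1 *: \sum_(j < m.+1) mu i (x j) *: residual p j
  else 0.

Fixpoint rpia (p0 : 'M[R]_(n.+1, d)) (idx : nat -> 'I_l.+1) (k : nat) :
    'M[R]_(n.+1, d) :=
  if k is k'.+1 then
    let p := rpia p0 idx k' in
    \matrix_(i < n.+1) (row i p + rpia_delta p (idx k') i)
  else p0.

End Rpia.
End Fitting.

Section RandomIndices.
Variables (R : realType) (dT : measure_display) (T : measurableType dT).
Variable P : probability T R.

(* The value types below are finite, with the discrete sigma-algebra. *)
Definition discrete_measurable_rv (S : finType) (X : T -> S) : Prop :=
  forall B : set S, measurable (X @^-1` B).

Definition discrete_independent (S U : finType) (X : T -> S) (Y : T -> U) :
    Prop :=
  forall (B : set S) (C : set U),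
    P (X @^-1` B `&` Y @^-1` C) = (P (X @^-1` B) * P (Y @^-1` C))%E.

Definition past (S : finType) (X : nat -> T -> S) (k : nat) (w : T) :
    {ffun 'I_k -> S} :=
  [ffun j : 'I_k => X j w].

Definition independent_of_past (S : finType) (X : nat -> T -> S) : Prop :=
  forall k : nat, discrete_independent (X k) (past X k).

(* E[X_k] --> v for random vectors; the expectation is taken coordinatewise,
   in \bar R. *)
Definition cvg_in_expectation (d : nat) (X : nat -> T -> 'rV[R]_d)
    (v : 'rV[R]_d) : Prop :=
  forall c : 'I_d,
    (fun k => 'E_P[fun w => X k w ord0 c]%E) @ \oo --> (v ord0 c)%:E.

End RandomIndices.

(* Main.v *)
Require Import Defs.
From mathcomp Require Import ring lra.

(** Write [A] for the collocation matrix, [W = |A|^2] for its squared Frobenius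
    norm (the total weight), and [W_s] for the weight of the block [I_s].  A
    step with index [s] adds [W_s^-1 A^T (q - A p)] to the rows of [p] in [I_s],
    and [s] is drawn with probability [W_s / W]: the two block weights cancel,
    and since the blocks partition the rows, a step averages to
    [p + W^-1 A^T (q - A p)] ([mean_rpia_step]).  The current points depend only
    on the past draws, of which the new one is independent, and the averaged
    step is affine in [p]; hence the means [M_k] of the control points follow
    the deterministic recursion [M_(k+1) = M_k + W^-1 A^T (q - A M_k)]
    ([mean_rpiaS]), which is gradient descent for the least-squares problem.

    A minimizer [pmin] satisfies [A^T (q - A pmin) = 0] ([normal_equation]), so
    the error [E_k = M_k - pmin] satisfies [E_(k+1) = E_k - W^-1 A^T A E_k].  This
    is a contraction: the submultiplicativity of the Frobenius norm
    (Cauchy-Schwarz) shows that a step lowers [|E|^2] by at least [W^-1 |A E|^2], and a left inverse of [A], which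
    exists by full column rank, bounds [|A E|^2] below by a multiple of [|E|^2]
    ([frob2_descent]).  Therefore [M_k] tends to [pmin] geometrically.  Rows and
    curve points are linear images [u *m p] of the control points, and
    expectation commutes with them ([expectation_rpia_linear]), which gives both
    conclusions.

    As the draws have finitely many values, so has everything computed from
    finitely many of them, and all expectations are finite sums
    ([expectation_finite]). *)

Set Implicit Arguments.
Unset Strict Implicit.
Unset Printing Implicit Defensive.

Import Order.TTheory GRing.Theory Num.Theory.
Import numFieldNormedType.Exports.

Local Open Scope classical_set_scope.
Local Open Scope ring_scope.

(** * The Frobenius norm and gradient descent for least squares *)

Section Frobenius.
Variable R : realFieldType.

Definition frob (a b : nat) (M N : 'M[R]_(a, b)) : R :=
  \sum_i \sum_j M i j * N i j.

Definition frob2 (a b : nat) (M : 'M[R]_(a, b)) : R := frob M M.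

Lemma frob_trace (a b : nat) (M N : 'M[R]_(a, b)) :
  frob M N = \tr (M^T *m N).
Proof.
rewrite /frob /mxtrace exchange_big; apply: eq_bigr => j _.
by rewrite mxE; apply: eq_bigr => i _; rewrite mxE.
Qed.

Lemma frob_mulmxl (a b c : nat) (A : 'M[R]_(a, b)) (X : 'M[R]_(b, c)) Y :
  frob (A *m X) Y = frob X (A^T *m Y).
Proof. by rewrite !frob_trace trmx_mul mulmxA. Qed.

Lemma frob2_ge0 (a b : nat) (M : 'M[R]_(a, b)) : 0 <= frob2 M.
Proof. by do 2!apply: sumr_ge0 => ? _; rewrite -expr2 sqr_ge0. Qed.

Lemma sqr_le_frob2 (a b : nat) (M : 'M[R]_(a, b)) i j :
  M i j ^+ 2 <= frob2 M.
Proof.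
rewrite /frob2 /frob (bigD1 i) //= (bigD1 j) //= -expr2 -addrA lerDl.
by rewrite addr_ge0 //; do ?[apply: sumr_ge0 => ? _]; rewrite -expr2 sqr_ge0.
Qed.

Lemma frob2_eq0 (a b : nat) (M : 'M[R]_(a, b)) : frob2 M <= 0 -> M = 0.
Proof.
move=> M0; apply/matrixP => i j; rewrite mxE; apply/eqP.
by rewrite -sqrf_eq0 eq_le sqr_ge0 (le_trans (sqr_le_frob2 M i j)).
Qed.

Lemma frob2_tr (a b : nat) (M : 'M[R]_(a, b)) : frob2 M^T = frob2 M.
Proof.
rewrite /frob2 /frob exchange_big; apply: eq_bigr => i _.
by apply: eq_bigr => j _; rewrite !mxE.
Qed.

Lemma frob2_subZ (a b : nat) (M N : 'M[R]_(a, b)) (t : R) :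
  frob2 (M - t *: N) = frob2 M - 2 * t * frob M N + t ^+ 2 * frob2 N.
Proof.
rewrite /frob2 /frob !mulr_sumr -sumrB -big_split; apply: eq_bigr => i _ /=.
rewrite !mulr_sumr -sumrB -big_split; apply: eq_bigr => j _ /=.
by rewrite !mxE; ring.
Qed.

(** Lagrange's identity exhibits the difference of the two sides as half of a
    sum of squares. *)
Lemma sum_CauchySchwarz (J : finType) (f g : J -> R) :
  (\sum_j f j * g j) ^+ 2 <= (\sum_j f j ^+ 2) * (\sum_j g j ^+ 2).
Proof.
have: 0 <= \sum_i \sum_j (f i * g j - f j * g i) ^+ 2.
  by do 2!apply: sumr_ge0 => ? _; exact: sqr_ge0.
suff -> : \sum_i \sum_j (f i * g j - f j * g i) ^+ 2 =
    2 * ((\sum_j f j ^+ 2) * (\sum_j g j ^+ 2) - (\sum_j f j * g j) ^+ 2).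
  by rewrite pmulr_rge0 // subr_ge0.
have -> : 2 * ((\sum_j f j ^+ 2) * (\sum_j g j ^+ 2) - (\sum_j f j * g j) ^+ 2)
    = (\sum_j f j ^+ 2) * (\sum_j g j ^+ 2)
    + (\sum_j g j ^+ 2) * (\sum_j f j ^+ 2)
    - 2 * ((\sum_j f j * g j) * (\sum_j f j * g j)) by ring.
rewrite !big_distrlr /= !mulr_sumr -big_split -sumrB; apply: eq_bigr => i _ /=.
rewrite !mulr_sumr -big_split -sumrB; apply: eq_bigr => j _ /=.
by ring.
Qed.

(** Each entry of the product is a dot product of a row of [M] and a column of
    [N], to which Cauchy-Schwarz applies. *)
Lemma frob2_mulmx (a b c : nat) (M : 'M[R]_(a, b)) (N : 'M[R]_(b, c)) :
  frob2 (M *m N) <= frob2 M * frob2 N.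
Proof.
rewrite -(frob2_tr N) /frob2 /frob big_distrlr; apply: ler_sum => i _ /=.
apply: ler_sum => k _; rewrite mxE -expr2.
apply: le_trans (sum_CauchySchwarz _ _) _; rewrite le_eqVlt; apply/orP; left.
by apply/eqP; congr (_ * _); apply: eq_bigr => j _; rewrite ?mxE expr2.
Qed.

(** One step of gradient descent with step size [t = 1 / frob2 A] removes
    [2 t |A E|^2] from the squared norm and adds back
    [t^2 |A^T A E|^2 <= t |A E|^2], hence loses at least [t |A E|^2]; a left
    inverse of [A] bounds that loss below by a multiple of [|E|^2].  Adding
    one in the denominator keeps the contraction factor nonnegative. *)
Lemma frob2_descent (a b c : nat) (A : 'M[R]_(a, b)) (L : 'M[R]_(b, a))
    (E : 'M[R]_(b, c)) :
  L *m A = 1%:M -> 0 < frob2 A ->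
  frob2 (E - (frob2 A)^-1 *: (A^T *m (A *m E))) <=
  (1 - (frob2 A * frob2 L + 1)^-1) * frob2 E.
Proof.
move=> LA W0; set W := frob2 A in W0 *; set K := frob2 L.
have K0 : 0 <= K := frob2_ge0 L.
have AE : frob2 (A^T *m (A *m E)) <= W * frob2 (A *m E).
  by rewrite (le_trans (frob2_mulmx _ _)) // frob2_tr.
have EL : frob2 E <= K * frob2 (A *m E).
  by rewrite -{1}(mul1mx E) -LA -mulmxA frob2_mulmx.
have step : frob2 (E - W^-1 *: (A^T *m (A *m E))) <=
    frob2 E - W^-1 * frob2 (A *m E).
  rewrite frob2_subZ -frob_mulmxl -/(frob2 (A *m E)).
  have := ler_wpM2l (sqr_ge0 W^-1) AE.
  by rewrite mulrA (expr2 W^-1) mulfVK ?gt_eqF //; lra.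
apply: le_trans step _; rewrite mulrBl mul1r lerD2l lerN2.
have D0 : 0 < W * K + 1 by rewrite ltr_wpDl // mulr_ge0 // ltW.
rewrite ler_pdivrMl // mulrCA ler_pdivlMl //.
have := frob2_ge0 (A *m E); have := ler_wpM2l (ltW W0) EL; lra.
Qed.

(** At a minimizer no gradient step can decrease the squared residual; but the
    step of size [1 / frob2 A] decreases it by at least
    [|A^T (q - A p)|^2 / frob2 A], so the gradient vanishes. *)
Lemma normal_equation (a b c : nat) (A : 'M[R]_(a, b)) (q : 'M[R]_(a, c))
    (p : 'M[R]_(b, c)) :
  0 < frob2 A ->
  (forall p', frob2 (q - A *m p) <= frob2 (q - A *m p')) ->
  A^T *m (q - A *m p) = 0.
Proof.
move=> W0 minp; set D := A^T *m _; apply: frob2_eq0.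
have := minp (p + (frob2 A)^-1 *: D).
rewrite mulmxDr -scalemxAr opprD addrA frob2_subZ.
have -> : frob (q - A *m p) (A *m D) = frob2 D.
  by rewrite /frob2 {1}/D frob_mulmxl trmxK.
have AD := ler_wpM2l (sqr_ge0 (frob2 A)^-1) (frob2_mulmx A D).
rewrite mulrA (expr2 (frob2 A)^-1) mulfVK ?gt_eqF // in AD.
move=> H; rewrite -(pmulr_rle0 _ (x := (frob2 A)^-1)) ?invr_gt0 //.
by move: AD H; rewrite expr2; lra.
Qed.

End Frobenius.

Section ContractionLimit.
Variable R : realType.

Lemma cvg_entry_of_contraction (a b : nat) (M : nat -> 'M[R]_(a, b))
    (L : 'M[R]_(a, b)) (rho : R) :
  0 <= rho < 1 ->
  (forall k, frob2 (M k.+1 - L) <= rho * frob2 (M k - L)) ->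
  forall i j, (fun k => M k i j) @ \oo --> L i j.
Proof.
move=> /andP[rho0 rho1] contr i j.
have geo k : frob2 (M k - L) <= geometric (frob2 (M 0%N - L)) rho k.
  elim: k => [|k IH]; first by rewrite /= expr0 mulr1.
  apply: le_trans (contr k) _.
  by rewrite /= exprS mulrCA ler_wpM2l.
have /cvgr0Pnorm_lt cvg0 : geometric (frob2 (M 0%N - L)) rho @ \oo --> 0.
  by apply: cvg_geometric; rewrite ger0_norm.
apply/cvgrPdist_lt => e e0; near=> k.
have small : (M k i j - L i j) ^+ 2 < e ^+ 2.
  have := sqr_le_frob2 (M k - L) i j; rewrite !mxE => /le_lt_trans; apply.
  apply: le_lt_trans (geo k) _; apply: le_lt_trans (ler_norm _) _.
  by near: k; apply: cvg0; rewrite exprn_gt0.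
rewrite distrC; rewrite -real_normK ?num_real // in small.
by rewrite ltr_pXn2r // ?nnegrE // ltW in small.
Unshelve. all: by end_near. Qed.

End ContractionLimit.

(** * Expectations of functions of finite-valued random variables *)

Section FiniteValued.
Variables (R : realType) (dT : measure_display) (T : measurableType dT).
Variable P : probability T R.

Definition pmf (S : finType) (Z : T -> S) (s : S) : R :=
  fine (P (Z @^-1` [set s])).

Lemma pmfE (S : finType) (Z : T -> S) (s : S) :
  discrete_measurable_rv Z -> (pmf Z s)%:E = P (Z @^-1` [set s]).
Proof. by move=> mZ; rewrite fineK // fin_num_measure. Qed.

(** The function is a linear combination of the indicators of the fibres of
    [Z], so it is integrable whatever [g] is. *)
Lemma expectation_finite (S : finType) (Z : T -> S) (g : S -> R) :
  discrete_measurable_rv Z ->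
  'E_P[fun w => g (Z w)]%E = (\sum_s pmf Z s * g s)%:E.
Proof.
move=> mZ; pose A s := Z @^-1` [set s].
have Aint s : P.-integrable [set: T] (EFin \o (fun w => g s * \1_(A s) w)).
  have -> : EFin \o (fun w => g s * \1_(A s) w) =
      (fun w => (g s)%:E * (\1_(A s) w)%:E)%E.
    by apply/funext => w; rewrite /= EFinM.
  apply: integrableZl => //.
  by apply: integrable_indic; exact: mZ.
have -> : (fun w => g (Z w)) = (fun w => \sum_s g s * \1_(A s) w).
  apply/funext => w; rewrite (bigD1 (Z w)) //= big1 ?addr0 => [|s sZ].
    by rewrite indicE mem_set ?mulr1.
  rewrite indicE memNset ?mulr0 // => /= /esym sE.
  by rewrite sE eqxx in sZ.
rewrite unlock.
under eq_integral do rewrite -sumEFin.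
rewrite integral_sum //= -sumEFin; apply: eq_bigr => s _.
under eq_integral do rewrite EFinM.
rewrite integralZl //; last first.
  apply: integrable_indic => //; exact: mZ.
rewrite integral_indic //; last exact: mZ.
by rewrite setIT EFinM muleC pmfE.
Qed.

Lemma sum_pmf (S : finType) (Z : T -> S) :
  discrete_measurable_rv Z -> \sum_s pmf Z s = 1.
Proof.
move=> mZ; have := expectation_finite (fun=> 1) mZ.
rewrite expectation_cst => -[->].
by apply: eq_bigr => s _; rewrite mulr1.
Qed.

Lemma discrete_measurable_pair (S U : finType) (X : T -> S) (Y : T -> U) :
  discrete_measurable_rv X -> discrete_measurable_rv Y ->
  discrete_measurable_rv (fun w => (X w, Y w)).
Proof.
move=> mX mY B.
have -> : (fun w => (X w, Y w)) @^-1` B =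
    \big[setU/set0]_(z <- enum {: S * U} | z \in B)
      (X @^-1` [set z.1] `&` Y @^-1` [set z.2]).
  rewrite -bigcup_seq_cond; apply/seteqP; split=> w /=.
    by move=> Bw; exists (X w, Y w) => //=; rewrite mem_enum mem_set.
  by move=> [[s u]] /= /andP[_ /set_mem Bz] [-> ->].
by apply: bigsetU_measurable => z _; apply: measurableI.
Qed.

(** There are finitely many pasts, and each one is a finite intersection of
    events about single indices. *)
Lemma discrete_measurable_past (S : finType) (X : nat -> T -> S) (k : nat) :
  (forall j, discrete_measurable_rv (X j)) ->
  discrete_measurable_rv (past X k).
Proof.
move=> mX B.
have -> : past X k @^-1` B =
    \big[setU/set0]_(y <- enum {: {ffun 'I_k -> S}} | y \in B)
      \big[setI/setT]_(j <- enum 'I_k) (X j @^-1` [set y j]).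
  rewrite -bigcup_seq_cond; apply/seteqP; split=> w /=.
    move=> Bw; exists (past X k w) => /=; first by rewrite mem_enum mem_set.
    by rewrite -bigcap_seq => j /= _; rewrite ffunE.
  move=> [y] /= /andP[_ /set_mem By]; rewrite -bigcap_seq => Xy.
  suff -> : past X k w = y by [].
  by apply/ffunP => j; rewrite ffunE; apply: Xy; rewrite /= mem_enum.
apply: bigsetU_measurable => y _; apply: bigsetI_measurable => j _; exact: mX.
Qed.

(** Independence in the form needed for a randomized iteration: [Y] is the past,
    [X] the new draw, and the inner sum averages the step over the draw with the
    past held fixed. *)
Lemma expectation_indep (S U : finType) (X : T -> S) (Y : T -> U)
    (g : U -> S -> R) :
  discrete_measurable_rv X -> discrete_measurable_rv Y ->
  discrete_independent P X Y ->
  'E_P[fun w => g (Y w) (X w)]%E =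
  (\sum_u pmf Y u * \sum_s pmf X s * g u s)%:E.
Proof.
move=> mX mY XY.
rewrite (expectation_finite (fun z : S * U => g z.2 z.1)
  (discrete_measurable_pair mX mY)).
congr EFin; under [RHS]eq_bigr do rewrite mulr_sumr.
rewrite [RHS]exchange_big pair_bigA /=; apply: eq_bigr => -[s u] _ /=.
rewrite mulrA; congr (_ * _).
rewrite [RHS]mulrC; apply: EFin_inj; rewrite EFinM !pmfE //; last first.
  exact: discrete_measurable_pair.
rewrite -XY; congr (P _); apply/seteqP; split=> w /= [].
  by move=> <- <-.
by move=> -> ->.
Qed.

End FiniteValued.

(** * The average of one step *)

Section Iteration.
Variables (R : realType) (m n d l : nat).
Variables (mu : 'I_n.+1 -> R -> R) (x : 'I_m.+1 -> R) (q : 'M[R]_(m.+1, d)).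
Variable I : 'I_l.+1 -> {set 'I_n.+1}.

Local Notation A := (collocation_mx mu x).

Lemma curve_mulmx (p : 'M[R]_(n.+1, d)) (t : R) :
  curve mu p t = (\row_i mu i t) *m p.
Proof.
by rewrite mulmx_sum_row; apply: eq_bigr => i _; rewrite mxE.
Qed.

Lemma residual_row (p : 'M[R]_(n.+1, d)) j :
  residual mu x q p j = row j (q - A *m p).
Proof.
rewrite /residual curve_mulmx raddfB /= row_mul; congr (_ - _ *m _).
by apply/rowP => i; rewrite !mxE.
Qed.

Definition rpia_step (p : 'M[R]_(n.+1, d)) (s : 'I_l.+1) : 'M[R]_(n.+1, d) :=
  \matrix_(i < n.+1) (row i p + rpia_delta mu x q I p s i).

Lemma rpia_stepE (p : 'M[R]_(n.+1, d)) s i c :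
  rpia_step p s i c = p i c +
    if i \in I s then (block_weight mu x I s)^-1 * (A^T *m (q - A *m p)) i c
    else 0.
Proof.
rewrite !mxE /rpia_delta; case: ifP => _; last by rewrite mxE.
rewrite mxE summxE; congr (_ + _ * _); apply: eq_bigr => j _.
by rewrite residual_row mxE !mxE.
Qed.

Lemma rpia_eq (p0 : 'M[R]_(n.+1, d)) f g k :
  (forall j, (j < k)%N -> f j = g j) ->
  rpia mu x q I p0 f k = rpia mu x q I p0 g k.
Proof.
elim: k => [//|k IH] fg; rewrite /= (IH (fun j jk => fg j (ltnW jk))).
by rewrite fg.
Qed.

(** Row [i] moves for exactly one block, namely the one containing [i]; there
    the block weight in the probability cancels the one in the step. *)
Lemma mean_rpia_step (p : 'M[R]_(n.+1, d)) i c :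
  indexed_partition I ->
  (forall s, block_weight mu x I s != 0) -> total_weight mu x != 0 ->
  \sum_s (block_weight mu x I s / total_weight mu x) * rpia_step p s i c =
  (p + (total_weight mu x)^-1 *: (A^T *m (q - A *m p))) i c.
Proof.
move=> [_ disj cov] w0 W0; set W := total_weight mu x in W0 *.
have blk i' : exists s0, forall s, (i' \in I s) = (s == s0).
  have : i' \in finset.setT by rewrite finset.in_setT.
  rewrite -cov => /finset.bigcupP[s0 _ is0]; exists s0 => s.
  case: eqVneq => [-> //|ss0]; apply: contraTF is0 => is_.
  by rewrite (disjointFr (disj _ _ ss0) is_).
have [s0 iIs] := blk i.
have sumw : \sum_s block_weight mu x I s = W.
  rewrite /block_weight (exchange_big_dep predT) //=; apply: eq_bigr => i' _.
  by have [s1 iIs1] := blk i'; rewrite (eq_bigl _ _ iIs1) big_pred1_eq.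
under eq_bigr do rewrite rpia_stepE mulrDr iIs.
rewrite big_split /= -mulr_suml -mulr_suml sumw divff // mul1r.
rewrite (bigD1 s0) //= eqxx big1 ?addr0 => [|s /negPf->]; last by rewrite mulr0.
rewrite [RHS]mxE [X in _ = _ + X]mxE; congr (_ + _).
by rewrite mulrACA divff // mul1r.
Qed.

End Iteration.

(** * The recursion for the mean control points *)

Section MeanIteration.
Variables (R : realType) (m n d l : nat).
Variables (mu : 'I_n.+1 -> R -> R) (x : 'I_m.+1 -> R) (q : 'M[R]_(m.+1, d)).
Variables (I : 'I_l.+1 -> {set 'I_n.+1}) (p0 : 'M[R]_(n.+1, d)).
Variables (dT : measure_display) (T : measurableType dT).
Variables (P : probability T R) (idx : nat -> T -> 'I_l.+1).
Hypothesis idx_meas : forall k, discrete_measurable_rv (idx k).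

Local Notation A := (collocation_mx mu x).

(** Only the indices below [k] matter after [k] steps, so any extension of [y]
    to a sequence will do. *)
Definition rpia_of_past (k : nat) (y : {ffun 'I_k -> 'I_l.+1}) :
    'M[R]_(n.+1, d) :=
  rpia mu x q I p0 (fun j => oapp y ord0 (insub j)) k.

Lemma rpia_past k w :
  rpia mu x q I p0 (fun j => idx j w) k = rpia_of_past (past idx k w).
Proof. by apply: rpia_eq => j jk; rewrite insubT /= ffunE. Qed.

(** The expectation of the control points, written as a finite sum over the
    possible pasts so that it is a real matrix and linear algebra applies. *)
Definition mean_rpia (k : nat) : 'M[R]_(n.+1, d) :=
  \sum_y pmf P (past idx k) y *: rpia_of_past y.

Lemma mean_rpiaE k i c :
  mean_rpia k i c = \sum_y pmf P (past idx k) y * rpia_of_past y i c.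
Proof. by rewrite summxE; apply: eq_bigr => y _; rewrite mxE. Qed.

Lemma expectation_rpia_linear (k : nat) (u : 'rV[R]_n.+1) c :
  'E_P[fun w => (u *m rpia mu x q I p0 (fun j => idx j w) k) ord0 c]%E =
  ((u *m mean_rpia k) ord0 c)%:E.
Proof.
under eq_fun do rewrite rpia_past.
rewrite (expectation_finite P (fun y => (u *m rpia_of_past y) ord0 c)
  (discrete_measurable_past (k := k) idx_meas)).
congr EFin; rewrite mulmx_sumr summxE; apply: eq_bigr => y _.
by rewrite -scalemxAr [RHS]mxE.
Qed.

Hypothesis Ipart : indexed_partition I.
Hypothesis weight_neq0 : forall s, block_weight mu x I s != 0.
Hypothesis total_neq0 : total_weight mu x != 0.
Hypothesis idx_law : forall k s,
  P (idx k @^-1` [set s]) = (block_weight mu x I s / total_weight mu x)%:E.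
Hypothesis idx_indep : independent_of_past P idx.

(** Averaging over the draw gives one affine step for each fixed past; averaging
    that over the past commutes with the affine map because the probabilities of
    the pasts add up to one. *)
Lemma mean_rpiaS k :
  mean_rpia k.+1 = mean_rpia k +
    (total_weight mu x)^-1 *: (A^T *m (q - A *m mean_rpia k)).
Proof.
have mpast j := discrete_measurable_past (k := j) idx_meas.
set t := (total_weight mu x)^-1.
have -> : mean_rpia k + t *: (A^T *m (q - A *m mean_rpia k)) =
    \sum_y pmf P (past idx k) y *:
      (rpia_of_past y + t *: (A^T *m (q - A *m rpia_of_past y))).
  under [RHS]eq_bigr do rewrite scalerDr.
  rewrite big_split /=; congr (_ + _).
  under eq_bigr => y _ do
    rewrite mulmxBr scalerBr scalerBr mulmxA scalemxAr -scalemxAr.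
  rewrite sumrB -scaler_suml sum_pmf // scale1r.
  rewrite mulmxBr scalerBr; congr (_ - _).
  rewrite mulmxA /mean_rpia mulmx_sumr scaler_sumr; apply: eq_bigr => y _.
  by rewrite -!scalemxAr scalerA mulrC -scalerA.
apply/matrixP => i c; rewrite [RHS]summxE; apply: EFin_inj.
rewrite mean_rpiaE -(expectation_finite P _ (mpast k.+1)).
(* Expose the last step, then express its starting point through the past. *)
under eq_fun do rewrite -rpia_past /= rpia_past.
rewrite (expectation_indep
  (fun y s => rpia_step mu x q I (rpia_of_past y) s i c)
  (@idx_meas k) (mpast k) (@idx_indep k)).
congr EFin; apply: eq_bigr => y _; rewrite [RHS]mxE.
rewrite -(mean_rpia_step _ _ _ _ Ipart) //.
by congr (_ * _); apply: eq_bigr => s _; rewrite /pmf idx_law.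
Qed.

End MeanIteration.

(** * Weights and errors as Frobenius norms; convergence *)

Section LeastSquares.
Variables (R : realType) (m n d l : nat).
Variables (mu : 'I_n.+1 -> R -> R) (x : 'I_m.+1 -> R) (q : 'M[R]_(m.+1, d)).

Local Notation A := (collocation_mx mu x).

Lemma total_weight_frob2 : total_weight mu x = frob2 A.
Proof.
rewrite /frob2 /frob exchange_big; apply: eq_bigr => i _.
by apply: eq_bigr => j _; rewrite mxE expr2.
Qed.

Lemma sum_sqnorm2_residual (p : 'M[R]_(n.+1, d)) :
  \sum_j sqnorm2 (residual mu x q p j) = frob2 (q - A *m p).
Proof.
apply: eq_bigr => j _; apply: eq_bigr => c _.
by rewrite residual_row [row _ _ _ _]mxE expr2.
Qed.

(** A zero column of [A] would make a diagonal entry of [L *m A = 1] vanish. *)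
Lemma col_weight_gt0 i :
  \rank A = n.+1 -> 0 < \sum_(j < m.+1) mu i (x j) ^+ 2.
Proof.
move=> rkA; have /row_fullP[L LA] : row_full A by apply/eqP.
rewrite lt_neqAle sumr_ge0 ?andbT => [|j _]; last exact: sqr_ge0.
apply/negP; rewrite eq_sym psumr_eq0 => [/allP Ai0|j _]; last exact: sqr_ge0.
have := congr1 (fun B : 'M[R]_(n.+1) => B i i) LA.
rewrite !mxE eqxx big1 => [/eqP|j _]; first by rewrite eq_sym oner_eq0.
rewrite mxE; have /eqP := Ai0 j (mem_index_enum j).
by move=> /eqP; rewrite sqrf_eq0 => /eqP ->; rewrite mulr0.
Qed.

Lemma block_weight_gt0 (I : 'I_l.+1 -> {set 'I_n.+1}) s :
  \rank A = n.+1 -> indexed_partition I -> 0 < block_weight mu x I s.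
Proof.
move=> rkA [In0 _ _]; have /finset.set0Pn[i iIs] : I s != finset.set0.
  by apply/eqP; exact: In0.
rewrite /block_weight (bigD1 i) //= ltr_pwDl ?col_weight_gt0 //.
by do 2!apply: sumr_ge0 => ? _; exact: sqr_ge0.
Qed.

Lemma total_weight_gt0 : \rank A = n.+1 -> 0 < total_weight mu x.
Proof.
move=> rkA; rewrite /total_weight (bigD1 ord0) //= ltr_pwDl ?col_weight_gt0 //.
by do 2!apply: sumr_ge0 => ? _; exact: sqr_ge0.
Qed.

End LeastSquares.

Theorem theorem4p1 (R : realType) (m n l d : nat)
    (hd : d = 2%N \/ d = 3%N)
    (mu : 'I_n.+1 -> R -> R) (x : 'I_m.+1 -> R)
    (x01 : forall h : 'I_m.+1, 0 <= x h <= 1)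
    (xincr : forall h h' : 'I_m.+1, (h < h')%N -> x h < x h')
    (Arank : \rank (collocation_mx mu x) = n.+1)
    (hmn : (n.+1 < m.+1)%N)
    (q : 'M[R]_(m.+1, d))
    (I : 'I_l.+1 -> {set 'I_n.+1})
    (Ipart : indexed_partition I)
    (p0 : 'M[R]_(n.+1, d))
    (dT : measure_display) (T : measurableType dT) (P : probability T R)
    (idx : nat -> T -> 'I_l.+1)
    (idx_meas : forall k : nat, discrete_measurable_rv (idx k))
    (idx_law : forall (k : nat) (s : 'I_l.+1),
      P (idx k @^-1` [set s]) =
      (block_weight mu x I s / total_weight mu x)%:E)
    (idx_indep : independent_of_past P idx)
    (pstar : 'M[R]_(n.+1, d))
    (hpstar : least_squares_points mu x q pstar) :
  let p (k : nat) (w : T) : 'M[R]_(n.+1, d) :=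
    rpia mu x q I p0 (fun j => idx j w) k in
  (forall i : 'I_n.+1,
     cvg_in_expectation P (fun k w => row i (p k w)) (row i pstar)) /\
  (forall t : R, x ord0 <= t <= x ord_max ->
     cvg_in_expectation P (fun k w => curve mu (p k w) t) (curve mu pstar t)).
Proof.
set A := collocation_mx mu x in Arank.
have W0 : 0 < frob2 A by rewrite -total_weight_frob2 total_weight_gt0.
have /row_fullP[L LA] : row_full A by apply/eqP.
pose M := mean_rpia mu x q I p0 P idx.
have grad0 : A^T *m (q - A *m pstar) = 0.
  apply: normal_equation => // p'.
  by rewrite -!sum_sqnorm2_residual; exact: hpstar.
(* Subtracting the gradient at [pstar], which vanishes, turns the affine
   recursion for the means into a linear one for the error. *)
have Merr k : M k.+1 - pstar =
    (M k - pstar) - (frob2 A)^-1 *: (A^T *m (A *m (M k - pstar))).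
  rewrite /M mean_rpiaS //; last 2 first.
  - by move=> s; rewrite gt_eqF // block_weight_gt0.
  - by rewrite gt_eqF // total_weight_gt0.
  rewrite total_weight_frob2 -/A -/(M k) addrAC; congr (_ + _).
  rewrite -scalerN; congr (_ *: _).
  rewrite -[LHS]subr0 -grad0 -mulmxBr -[RHS]mulmxN; congr (_ *m _).
  by rewrite mulmxBr opprB opprB addrC addrA subrK.
pose D := frob2 A * frob2 L + 1.
have D1 : 1 <= D by rewrite lerDr mulr_ge0 ?frob2_ge0.
have D0 : 0 < D := lt_le_trans ltr01 D1.
have Mcvg i c : (fun k => M k i c) @ \oo --> pstar i c.
  apply: (@cvg_entry_of_contraction _ _ _ M pstar (1 - D^-1)) => [|k].
    by rewrite subr_ge0 invf_le1 // D1 ltrBlDr ltrDl invr_gt0.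
  by rewrite Merr frob2_descent.
have cvg_image (f : 'M[R]_(n.+1, d) -> 'rV[R]_d) (u : 'rV[R]_n.+1) :
    (forall p, f p = u *m p) ->
    cvg_in_expectation P
      (fun k w => f (rpia mu x q I p0 (fun j => idx j w) k)) (f pstar).
  move=> /funext -> c.
  under eq_fun do rewrite expectation_rpia_linear //.
  apply: cvg_EFin; first exact: nearW.
  rewrite mxE; under [X in X @ _]eq_fun do rewrite /= mxE.
  apply: cvg_big => [|i _]; first exact: add_continuous.
  by apply: cvgMl_tmp; exact: Mcvg.
split=> [i|t _]; first by apply: cvg_image => p'; exact: rowE.
by apply: (cvg_image (fun p' => curve mu p' t)) => p'; exact: curve_mulmx.
Qed.
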